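(* Let $\leq$ be the standard order on $\mathbb{Q}$. The set $L_{(\mathbb{Q},\leq)}=\{y\in\mathbb{Q}^\omega: (\exists k_0<k_1<\ldots)(\forall i\in\omega)(y(k_i)\leq y(k_{i+1}))\}$ is a $\mathbf{\Sigma}_1^1$-complete subset of $\mathbb{Q}^\omega$.
   Context: Here $\omega$ is the set of natural numbers (including $0$), and $k_0<k_1<\ldots$ ranges over strictly increasing sequences of elements of $\omega$. The space $\mathbb{Q}^\omega$ carries the product topology with $\mathbb{Q}$ treated as a countable discrete space, so it is a Polish space homeomorphic to the Baire space $\omega^\omega$. A subset $A$ of a Polish space $\mathcal{X}$ is $\mathbf{\Sigma}_1^1$-complete if $A$ is analytic and for every Polish space $\mathcal{Y}$ and every analytic $B\subseteq\mathcal{Y}$ there is a Borel map $f:\mathcal{Y}\to\mathcal{X}$ such that $f^{-1}(A)=B$. *)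

(* Defs.v *)
From HB Require Import structures.
From mathcomp Require Import all_boot all_order all_algebra.
From mathcomp Require Import all_classical all_reals all_analysis.

Set Implicit Arguments.
Unset Strict Implicit.
Unset Printing Implicit Defensive.

Import Order.TTheory GRing.Theory Num.Theory.

Local Open Scope classical_set_scope.
Local Open Scope ring_scope.

(* The library's [metricType] bundles a metric with a topology; here metrics
   are unbundled, so that complete metrizability is a predicate on a given
   topological space. *)
Definition is_metric (R : realType) (T : Type) (d : T -> T -> R) : Prop :=
  [/\ forall x y, 0 <= d x y,
      forall x y, d x y = 0 <-> x = y,
      forall x y, d x y = d y x &
      forall x y z, d x z <= d x y + d y z].

Definition metric_compatible (R : realType) (T : topologicalType)
    (d : T -> T -> R) : Prop :=
  forall (x : T) (A : set T),
    nbhs x A <-> exists2 e : R, 0 < e & [set y | d x y < e] `<=` A.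

Definition metric_cauchy (R : realType) (T : Type) (d : T -> T -> R)
    (u : nat -> T) : Prop :=
  forall e : R, 0 < e ->
    exists N : nat, forall m n : nat,
      (N <= m)%N -> (N <= n)%N -> d (u m) (u n) < e.

Definition metric_complete (R : realType) (T : topologicalType)
    (d : T -> T -> R) : Prop :=
  forall u : nat -> T, metric_cauchy d u -> exists l : T, u @ \oo --> l.

Definition completely_metrizable (R : realType) (T : topologicalType) : Prop :=
  exists d : T -> T -> R,
    [/\ is_metric d, metric_compatible d & metric_complete d].

Definition separable (T : topologicalType) : Prop :=
  exists2 D : set T, countable D & dense D.

(* Neither this definition nor [topologicalType] asks for a point, so the empty
   space is Polish. *)
Definition polish (R : realType) (T : topologicalType) : Prop :=
  separable T /\ completely_metrizable R T.

Definition borel (T : topologicalType) : set (set T) := <<s @open T >>.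

Definition borel_map (T U : topologicalType) (f : T -> U) : Prop :=
  forall A : set U, borel A -> borel (f @^-1` A).

(* A continuous image of a Polish space, possibly the empty one: set0 is
   analytic. *)
Definition analytic (R : realType) (T : topologicalType) (A : set T) : Prop :=
  exists Z : topologicalType, polish R Z /\
    exists2 f : Z -> T, continuous f & range f = A.

Definition Sigma11_complete (R : realType) (X : topologicalType)
    (A : set X) : Prop :=
  [/\ polish R X, analytic R A &
      forall (Y : topologicalType) (B : set Y), polish R Y -> analytic R B ->
        exists2 f : Y -> X, borel_map f & f @^-1` A = B].

Definition discrete_seq_space (Q : choiceType) : topologicalType :=
  prod_topology (fun _ : nat => discrete_topology Q).

Definition L_set (Q : choiceType) (r : rel Q) : set (discrete_seq_space Q) :=
  [set y : nat -> Q | exists k : nat -> nat,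
     (forall i, (k i < k i.+1)%N) /\ (forall i, r (y (k i)) (y (k i.+1)))].

(* Main.v *)
Require Import Defs.
From mathcomp Require Import all_boot all_order all_algebra.
From mathcomp Require Import all_classical all_reals all_analysis.
From mathcomp Require Import lra.

Set Implicit Arguments.
Unset Strict Implicit.
Unset Printing Implicit Defensive.

Import Order.TTheory GRing.Theory Num.Theory.

Local Open Scope classical_set_scope.
Local Open Scope ring_scope.

(* Hardness: an analytic B has a Souslin scheme of closed sets F s, so that y is
   in B iff the tree T_y of the finite sequences s with y \in F s has an infinite
   branch. The reverse Kleene-Brouwer order on finite sequences embeds in the
   rationals by a binary expansion kb, under which an ascending sequence in a
   tree forces an infinite branch, and a branch is itself ascending. Listing the
   values kb s for s in T_y, and filling the other positions with strictly
   decreasing negative values, yields a sequence that has a monotone subsequence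
   iff y is in B. It depends on y in a Borel way, as each entry depends on the
   membership of y in a single F s. *)

(** * Spaces of sequences *)

Definition cylinder (Q : choiceType) (x : nat -> Q) (n : nat) : set (nat -> Q) :=
  [set y | forall i, (i < n)%N -> y i = x i].

Lemma cylinderW (Q : choiceType) (x : nat -> Q) (m n : nat) :
  (m <= n)%N -> cylinder x n `<=` cylinder x m.
Proof. by move=> mn y yx i im; apply: yx; apply: leq_trans mn. Qed.

Lemma nbhs_cylinder (Q : choiceType) (x : discrete_seq_space Q)
    (A : set (discrete_seq_space Q)) :
  nbhs x A <-> exists n, cylinder x n `<=` A.
Proof.
split=> [|[n]].
  pose F : set_system (discrete_seq_space Q) := filter_from setT (cylinder x).
  have FF : Filter F.
    apply: filter_from_filter; first by exists 0%N.
    move=> i j _ _; exists (maxn i j) => // y yx.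
    by split; apply: cylinderW yx; rewrite ?leq_maxl ?leq_maxr.
  suff : F --> x by move=> Fx /Fx [n _ nA]; exists n.
  (* Convergence in the product is tested coordinatewise, and a cylinder of length [i.+1] fixes
     coordinate [i]. *)
  apply/cvg_sup => i U [_ [[V oV <-] Vx]] /filterS; apply.
  by exists i.+1 => // y yx /=; rewrite /proj yx.
move=> nA; suff xn : nbhs x (cylinder x n : set (discrete_seq_space Q)).
  exact: filterS nA xn.
elim: n {nA} => [|n IHn]; first by apply: filterS filterT.
have nx : nbhs x [set y : discrete_seq_space Q | y n = x n].
  exact: (@proj_continuous nat (fun=> discrete_topology Q) n x [set x n]).
apply: filterS (filterI IHn nx) => y [yx yn] i.
by rewrite ltnS leq_eqVlt => /orP[/eqP ->|/yx].
Qed.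

Lemma natSinv_lt (R : realType) (e : R) :
  0 < e -> exists n : nat, n.+1%:R^-1 < e.
Proof.
move=> e0; have [N _ /(_ N (leqnn N)) Ne] := near_infty_natSinv_lt (PosNum e0).
by exists N.
Qed.

(** The standard complete ultrametric of the Baire space, over an arbitrary alphabet. *)
Definition diff_dist (R : realType) (Q : choiceType) (x y : nat -> Q) : R :=
  if pselect (exists n, x n != y n) is left xy then (ex_minn xy).+1%:R^-1 else 0.

Lemma diff_dist_ge0 (R : realType) (Q : choiceType) (x y : nat -> Q) :
  0 <= diff_dist R x y.
Proof. by rewrite /diff_dist; case: pselect => // xy; rewrite invr_ge0. Qed.

(** A first difference at [m] gives distance [1/(m+1)], which is below [1/(n+1)] iff [n < m]. Balls
    are thus cylinders, and metric facts reduce to agreement of coordinates. *)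
Lemma diff_dist_lt (R : realType) (Q : choiceType) (x y : nat -> Q) (n : nat) :
  diff_dist R x y < n.+1%:R^-1 <-> cylinder x n.+1 y.
Proof.
rewrite /diff_dist; case: pselect => [xy|xy].
  case: ex_minnP => m xym minm.
  rewrite ltf_pV2 ?posrE ?ltr0n// ltr_nat; split=> [nm i i_n|nxy].
    apply/eqP; apply: contraTT (leq_ltn_trans i_n nm) => yxi.
    by rewrite -leqNgt !ltnS minm// eq_sym.
  rewrite ltnS ltnNge; apply/negP => mn.
  by rewrite (nxy m) ?eqxx// in xym.
rewrite invr_gt0 ltr0n; split=> // _ i _; apply/eqP/negP => /negP yxi.
by apply: xy; exists i; rewrite eq_sym.
Qed.

(** Nonzero distances have the form [n.+1%:R^-1], so a distance above [c] would be one of the radii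
    tested. *)
Lemma diff_dist_le (R : realType) (Q : choiceType) (x y : nat -> Q) (c : R) :
  0 <= c -> (forall n, c < n.+1%:R^-1 -> cylinder x n.+1 y) ->
  diff_dist R x y <= c.
Proof.
move=> c0 cxy; rewrite leNgt; apply/negP => cd.
have : exists n, diff_dist R x y = n.+1%:R^-1.
  move: cd; rewrite /diff_dist; case: pselect => [xy _|_]; first by eexists.
  by rewrite ltNge c0.
move=> [n dn]; have /(diff_dist_lt R) : cylinder x n.+1 y.
  by apply: cxy; rewrite -dn.
by rewrite -dn ltxx.
Qed.

Lemma cylinder_sym (Q : choiceType) (x y : nat -> Q) (n : nat) :
  cylinder x n y -> cylinder y n x.
Proof. by move=> yx i /yx. Qed.

Lemma diff_dist_metric (R : realType) (Q : choiceType) :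
  is_metric (@diff_dist R Q).
Proof.
have dC x y : diff_dist R x y <= @diff_dist R Q y x.
  apply: diff_dist_le; first exact: diff_dist_ge0.
  by move=> n; rewrite diff_dist_lt => /cylinder_sym.
split=> [x y|x y|x y|x y z].
- exact: diff_dist_ge0.
- split=> [d0|->]; last first.
    by apply/eqP; rewrite eq_le diff_dist_ge0 andbT diff_dist_le.
  apply/funext => n; have : cylinder x n.+1 y.
    by apply/(diff_dist_lt R); rewrite d0 invr_gt0.
  by move=> /(_ n (ltnSn n)).
- by apply/eqP; rewrite eq_le !dC.
- apply: diff_dist_le => [|n dn]; first by rewrite addr_ge0// diff_dist_ge0.
  have /diff_dist_lt xy : diff_dist R x y < n.+1%:R^-1.
    by apply: le_lt_trans dn; rewrite lerDl diff_dist_ge0.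
  have /diff_dist_lt yz : diff_dist R y z < n.+1%:R^-1.
    by apply: le_lt_trans dn; rewrite lerDr diff_dist_ge0.
  by move=> i i_n; rewrite yz// xy.
Qed.

Lemma diff_dist_compatible (R : realType) (Q : choiceType) :
  @metric_compatible R (discrete_seq_space Q) (@diff_dist R Q).
Proof.
move=> x A; rewrite nbhs_cylinder; split=> [[n nA]|[e e0 eA]].
  exists n.+1%:R^-1; first by rewrite invr_gt0.
  by move=> y /= /diff_dist_lt yx; apply: nA; apply: cylinderW yx.
have [n ne] := natSinv_lt e0.
by exists n.+1 => y /(diff_dist_lt R) yx; apply: eA => /=; apply: lt_trans ne.
Qed.

Lemma diff_dist_complete (R : realType) (Q : choiceType) :
  @metric_complete R (discrete_seq_space Q) (@diff_dist R Q).
Proof.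
move=> u cu.
have /choice[N uN] : forall n, exists N, forall m, (N <= m)%N ->
    cylinder (u N) n.+1 (u m).
  move=> n; have [|N uN] := cu n.+1%:R^-1; first by rewrite invr_gt0.
  by exists N => m Nm; apply/(diff_dist_lt R); exact: uN.
(* Coordinate [n] is constant from index [N n] on; the limit collects these eventual values. *)
exists (fun n => u (N n) n) => A; rewrite nbhs_cylinder => -[n nA].
exists (\max_(i < n) N i) => // m /= Nm; apply: nA => i i_n.
rewrite (uN i)//; apply: leq_trans Nm.
exact: (leq_bigmax (Ordinal i_n)).
Qed.

Lemma discrete_seq_space_separable (Q : countType) (q : Q) :
  separable (discrete_seq_space Q).
Proof.
exists (range (fun s : seq Q => nth q s)).
  by apply: card_le_trans (card_image_le _ _) _; exact: countableP.
move=> O [x Ox]; rewrite openE => /(_ x Ox); rewrite /interior.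
move=> /nbhs_cylinder[n nO]; exists (nth q (mkseq x n)); split.
  by apply: nO => i i_n; rewrite nth_mkseq.
by exists (mkseq x n).
Qed.

Lemma discrete_seq_space_polish (R : realType) (Q : countType) (q : Q) :
  polish R (discrete_seq_space Q).
Proof.
split; first exact: discrete_seq_space_separable q.
exists (@diff_dist R Q); split.
- exact: diff_dist_metric.
- exact: diff_dist_compatible.
- exact: diff_dist_complete.
Qed.

(** * Analyticity *)

Lemma causal_continuous (P Q : choiceType)
    (f : discrete_seq_space P -> discrete_seq_space Q) :
  (forall n x y, cylinder x n y -> cylinder (f x) n (f y)) -> continuous f.
Proof.
move=> fcyl x A /nbhs_cylinder[n nA]; apply/nbhs_cylinder.
by exists n => y /fcyl/nA.
Qed.

Lemma unbounded_subsequence (P : nat -> Prop) :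
  (forall n, exists m, (n <= m)%N /\ P m) ->
  exists2 k : nat -> nat, forall i, (k i < k i.+1)%N & forall i, P (k i).
Proof.
move=> /choice[next nextP].
exists (fun i => iter i (next \o S) (next 0%N)) => [i|[|i]] /=.
- by have [] := nextP (iter i (next \o S) (next 0%N)).+1.
- by have [] := nextP 0%N.
- by have [] := nextP (iter i (next \o S) (next 0%N)).+1.
Qed.

(** A counter that falls by one at each step and is reloaded from [g] after reaching 0. It vanishes
    infinitely often, so every [g] encodes an infinite set, that of its zeros. *)
Fixpoint countdown (g : nat -> nat) (n : nat) : nat :=
  if n is m.+1 then
    if countdown g m is j.+1 then j else g n
  else g 0%N.

Lemma countdown_zero (g : nat -> nat) (n : nat) :
  exists m, (n <= m)%N /\ countdown g m = 0%N.
Proof.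
(* Induction on the value of the counter, with its position left free. *)
elim: {n}(countdown g n) {-2}n (erefl (countdown g n)) => [|c IHc] n gn.
  by exists n.
have [|m [nm gm]] := IHc n.+1; first by rewrite /= gn.
by exists m; split=> //; exact: ltnW.
Qed.

Lemma eq_countdown (g h : nat -> nat) (n : nat) :
  (forall i, (i <= n)%N -> g i = h i) -> countdown g n = countdown h n.
Proof.
elim: n => [|n IHn] gh /=; first exact: gh.
by rewrite IHn ?gh// => i i_n; rewrite gh// leqW.
Qed.

(* The second component encodes an infinite set of marked positions; the values
   at marked positions are replaced by their running maximum, so that every
   code yields a sequence with a monotone subsequence. *)
Definition decode (z : nat -> rat * nat) (n : nat) : rat :=
  let g i := (z i).2 in
  if countdown g n == 0%N then
    \big[Order.max/(z n).1]_(m < n | countdown g m == 0%N) (z m).1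
  else (z n).1.

(** The value at [i] depends on the code up to [i] only, which makes [decode] continuous. *)
Lemma decode_cylinder (n : nat) (x y : nat -> rat * nat) :
  cylinder x n y -> cylinder (decode x) n (decode y).
Proof.
move=> xy i i_n; rewrite /decode.
have E j : (j <= i)%N -> countdown (fun i => (y i).2) j =
                         countdown (fun i => (x i).2) j.
  move=> ji; apply: eq_countdown => l lj.
  by rewrite xy// (leq_ltn_trans _ i_n)// (leq_trans lj).
rewrite E// xy//; case: ifP => // _.
apply: eq_big => [j|j _]; first by rewrite E// ltnW.
by rewrite xy// (ltn_trans (ltn_ord j)).
Qed.

Lemma decode_L_set (z : nat -> rat * nat) :
  L_set (fun p q : rat => p <= q) (decode z).
Proof.
have [k kS k0] := unbounded_subsequence (countdown_zero (fun i => (z i).2)).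
exists k; split=> // i; rewrite /decode !k0 !eqxx.
apply/bigmax_leP; split=> [|m m0].
  by apply: (bigmax_sup (Ordinal (kS i))) => //=; rewrite k0.
by apply: (bigmax_sup (widen_ord (ltnW (kS i)) m)).
Qed.

(** Mark the range of [k], taking for [g n] the distance from [n] to the next marked position. As
    [y] is nondecreasing there, the running maximum leaves it unchanged. *)
Lemma L_set_decode (y : nat -> rat) :
  L_set (fun p q : rat => p <= q) y -> exists z, decode z = y.
Proof.
move=> [k [kS yk]].
have k_ge n : (n <= k n)%N by elim: n => // n IHn; exact: leq_ltn_trans (kS n).
have k_mono : {homo k : i j / (i < j)%N} by apply: homo_ltn kS; exact: ltn_trans.
have yk_mono : {homo (y \o k) : i j / (i <= j)%N >-> i <= j}.
  by apply: homo_leq => //; exact: le_trans.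
pose hit n d := exists i, (n + d)%N = k i.
have /choice[g gP] : forall n, exists d,
    hit n d /\ forall d', hit n d' -> (d <= d')%N.
  move=> n; have hit_n : exists d, `[< hit n d >].
    by exists (k n - n)%N; apply/asboolP; exists n; rewrite subnKC.
  case: (ex_minnP hit_n) => d /asboolP nd mind; exists d; split=> // d' nd'.
  by apply: mind; apply/asboolP.
(* The distance to the next marked position falls by one until it vanishes, as the counter does. *)
have gE n : countdown g n = g n.
  elim: n => //= n ->; case gn : (g n) => [//|j].
  have [[i ni] ming] := gP n; have [[i' ni'] ming'] := gP n.+1.
  apply/eqP; rewrite eqn_leq -ltnS -gn ming; last first.
    by exists i'; rewrite addnS -addSn.
  by rewrite ming'//; exists i; rewrite addSnnS -gn.
have g0 n : reflect (exists i, n = k i) (g n == 0%N).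
  apply: (iffP eqP) => [gn|[i ni]].
    by have [[i]] := gP n; rewrite gn addn0; exists i.
  by apply/eqP; rewrite -leqn0; apply: (gP n).2; exists i; rewrite addn0.
exists (fun n => (y n, g n)); apply/funext => n; rewrite /decode /= gE.
case: (g0 n) => // -[i ->]; apply: bigmax_eq_id => -[m mn] /=.
rewrite gE => /g0[j mE]; rewrite mE; apply: yk_mono; rewrite leqNgt.
by apply/negP => /k_mono; rewrite -mE ltnNge ltnW.
Qed.

Lemma L_set_analytic (R : realType) :
  analytic R (L_set (fun p q : rat => (p <= q)%R)).
Proof.
exists (discrete_seq_space (rat * nat)%type); split.
  exact: discrete_seq_space_polish (0, 0%N).
exists decode; first by apply: causal_continuous; exact: decode_cylinder.
apply/seteqP; split=> [_ [z _ <-]|y /L_set_decode[z <-]].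
  exact: decode_L_set.
by exists z.
Qed.

(** * The Kleene-Brouwer order *)

(* The number with binary expansion 0.0^{a0} 1 0^{a1} 1 ... for s = [a0; a1; ...]. *)
Fixpoint kb (s : seq nat) : rat :=
  if s is a :: t then (1 + kb t) / 2 ^+ a.+1 else 0.

Lemma kb_itv (s : seq nat) : 0 <= kb s < 1.
Proof.
elim: s => [//|a s /andP[s0 s1]] /=.
have p2 : 0 < (2 : rat) ^+ a.+1 by rewrite exprn_gt0.
have p1 : 1 <= (2 : rat) ^+ a by rewrite exprn_ege1.
apply/andP; split; first by rewrite divr_ge0 ?addr_ge0 ?(ltW p2).
by rewrite ltr_pdivrMr// mul1r exprS; lra.
Qed.

Lemma kb_cons_gt0 (a : nat) (s : seq nat) : 0 < kb (a :: s).
Proof.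
have /andP[s0 _] := kb_itv s.
by rewrite /= divr_gt0 ?exprn_gt0// ltr_wpDr.
Qed.

(** A longer initial run of zeros makes a binary expansion smaller: if [a < b], then [1 / 2 ^+ b]
    separates the two values. *)
Lemma kb_cons_head (a b : nat) (s t : seq nat) :
  kb (a :: s) <= kb (b :: t) -> (b <= a)%N.
Proof.
apply: contraTT; rewrite -ltnNge -ltNge => ab /=.
have /andP[s0 _] := kb_itv s; have /andP[_ t1] := kb_itv t.
apply: (@lt_le_trans _ _ (1 / 2 ^+ b)).
  rewrite exprS invfM mulrA ltr_pM2r ?invr_gt0 ?exprn_gt0//; lra.
apply: ler_pM; rewrite ?invr_ge0 ?exprn_ge0 ?lerDl//.
by rewrite lef_pV2 ?posrE ?exprn_gt0// ler_eXn2l.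
Qed.

Lemma kb_cons_tail (a : nat) (s t : seq nat) :
  (kb (a :: s) < kb (a :: t)) = (kb s < kb t).
Proof. by rewrite /= ltr_pM2r ?ltrD2l// invr_gt0 exprn_gt0. Qed.

Lemma kb_inj : injective kb.
Proof.
elim=> [|a s IHs] [|b t] //.
- by move=> /esym E; have := kb_cons_gt0 b t; rewrite E ltxx.
- by move=> E; have := kb_cons_gt0 a s; rewrite E ltxx.
move=> E; have ab : a = b.
  apply/eqP; rewrite eqn_leq (@kb_cons_head b a t s) ?E//.
  by rewrite (@kb_cons_head a b s t) ?E.
rewrite -ab in E *; congr cons; apply: IHs; apply/eqP.
by rewrite eq_le !leNgt -(kb_cons_tail a t) -(kb_cons_tail a s) E ltxx.
Qed.

(** Appending an entry adds a binary digit 1. Hence the initial segments of a branch ascend. *)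
Lemma kb_rcons (s : seq nat) (a : nat) : kb s < kb (rcons s a).
Proof.
elim: s => [|b s IHs]; first exact: kb_cons_gt0.
by rewrite rcons_cons kb_cons_tail.
Qed.

(** The invariant of the descent that builds a branch; it passes from [u] to some child of [u]. *)
Definition kb_ascending (T : seq nat -> Prop) (u : seq nat) : Prop :=
  exists2 s : nat -> seq nat,
    forall i, kb (s i) < kb (s i.+1) & forall i, T (u ++ s i).

Lemma kb_ascending_step (T : seq nat -> Prop) (u : seq nat) :
  kb_ascending T u -> exists a, kb_ascending T (rcons u a).
Proof.
move=> [s sS Ts].
(* A term with a predecessor has positive [kb] and so is nonempty; [s 0] may be empty, hence the
   shift by one. *)
have /choice[at_ sE] : forall i, exists p : nat * seq nat, s i.+1 = p.1 :: p.2.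
  move=> i; case E : (s i.+1) => [|a t]; last by exists (a, t).
  have := sS i; rewrite E /= => s0; have /andP[] := kb_itv (s i).
  by rewrite leNgt s0.
pose A v := exists i, (at_ i).1 = v.
have exA : exists v, `[< A v >] by exists (at_ 0%N).1; apply/asboolP; exists 0%N.
(* The heads never increase, and [a] is the least of them, reached at [N]; from there on they all
   equal [a]. *)
case: (ex_minnP exA) => a /asboolP[N Na] mina.
have hd i : (at_ (N + i)%N).1 = a.
  elim: i => [|i IHi]; first by rewrite addn0.
  apply/eqP; rewrite eqn_leq mina; last by apply/asboolP; eexists.
  rewrite andbT -[X in (_ <= X)%N]IHi addnS.
  apply: (@kb_cons_head _ _ (at_ (N + i)%N).2 (at_ (N + i).+1).2).
  by rewrite -!sE ltW.
exists a, (fun i => (at_ (N + i)%N).2) => i.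
  rewrite -(kb_cons_tail a) -{1}(hd i) -(hd i.+1) -!sE addnS; exact: sS.
by rewrite cat_rcons -{1}(hd i) -sE.
Qed.

(* Along an ascending sequence the first entries are eventually nonincreasing,
   hence eventually constant; iterating on the tails yields the branch. *)
Lemma kb_ascending_branch (T : seq nat -> Prop) :
  (forall s t, T (s ++ t) -> T s) -> kb_ascending T [::] ->
  exists x : nat -> nat, forall n, T (mkseq x n).
Proof.
move=> Tpre T0.
have /choice[next nextP] : forall u, exists a,
    kb_ascending T u -> kb_ascending T (rcons u a).
  move=> u; have [/kb_ascending_step[a ?]|nu] := pselect (kb_ascending T u).
    by exists a.
  by exists 0%N.
pose b n := iter n (fun u => rcons u (next u)) [::].
have bE n : mkseq (next \o b) n = b n by elim: n => // n IHn; rewrite mkseqS IHn.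
exists (next \o b) => n; rewrite bE.
have [s _ /(_ 0%N)] : kb_ascending T (b n) by elim: n => //= n; exact: nextP.
exact: Tpre.
Qed.

(** * Borel maps *)

Lemma borelC (T : topologicalType) (A : set T) : borel A -> borel (~` A).
Proof. by move=> bA; rewrite -setTD; exact: sigma_algebraCD. Qed.

Lemma borelU (T : topologicalType) (A B : set T) :
  borel A -> borel B -> borel (A `|` B).
Proof.
move=> bA bB; rewrite -bigcup2E.
by apply: sigma_algebra_bigcup => -[|[|n]] //=; exact: sigma_algebra0.
Qed.

Lemma borelI (T : topologicalType) (A B : set T) :
  borel A -> borel B -> borel (A `&` B).
Proof.
move=> bA bB; rewrite -(setCK (A `&` B)) setCI.
by apply: borelC; apply: borelU; exact: borelC.
Qed.

Lemma borel_set0 (T : topologicalType) : borel (@set0 T).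
Proof. exact: sigma_algebra0. Qed.

Lemma borel_setT (T : topologicalType) : borel [set: T].
Proof. by rewrite -setC0; apply: borelC; exact: borel_set0. Qed.

Lemma borel_cst (T : topologicalType) (P : Prop) : borel [set _ : T | P].
Proof.
have [p|np] := pselect P.
  by rewrite (_ : mkset _ = setT) ?predeqE//; exact: borel_setT.
by rewrite (_ : mkset _ = set0) ?predeqE//; exact: borel_set0.
Qed.

Lemma borel_closed (T : topologicalType) (A : set T) : closed A -> borel A.
Proof.
move=> cA; rewrite -(setCK A); apply: borelC.
by apply: (@sub_sigma_algebra T setT (@open T)); exact: closed_openC.
Qed.

Lemma borel_bigcup_countType (T : topologicalType) (I : countType)
    (P : I -> Prop) (A : I -> set T) :
  (forall i, borel (A i)) -> borel (\bigcup_(i in P) A i).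
Proof.
move=> bA.
rewrite (_ : bigcup _ _ = \bigcup_n
    (if @unpickle I n is Some i then [set _ | P i] `&` A i else set0)).
  apply: sigma_algebra_bigcup => n; case: unpickle => [i|]; last first.
    exact: borel_set0.
  by apply: borelI => //; exact: borel_cst.
apply/seteqP; split=> [y [i Pi Aiy]|y [n _]].
  by exists (pickle i) => //; rewrite pickleK.
by case: unpickle => // i [Pi Aiy]; exists i.
Qed.

Lemma borel_map_preimage_open (T U : topologicalType) (f : T -> U) :
  (forall A, open A -> borel (f @^-1` A)) -> borel_map f.
Proof.
move=> fopen A; apply: (@smallest_sub _ _ _ [set B | borel (f @^-1` B)]) => //.
split=> /= [|B bB|B bB].
- by rewrite preimage_set0; exact: borel_set0.
- by rewrite setTD preimage_setC; exact: borelC.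
- by rewrite preimage_bigcup; exact: sigma_algebra_bigcup.
Qed.


(** As [Q] is countable, an open set is a countable union of cylinders, and the preimage of a
    cylinder is a finite intersection of sets assumed Borel. *)
Lemma borel_map_discrete_seq (T : topologicalType) (Q : countType)
    (f : T -> discrete_seq_space Q) :
  (forall n v, borel [set y | f y n = v]) -> borel_map f.
Proof.
move=> bf; apply: borel_map_preimage_open => U oU.
pose C (s : seq Q) := [set y | mkseq (f y) (size s) = s].
rewrite (_ : f @^-1` U = \bigcup_(s in
    [set s : seq Q | forall x, mkseq x (size s) = s -> U x]) C s).
  apply: borel_bigcup_countType; elim/last_ind => [|s v IHs].
    by rewrite (_ : C _ = setT) ?predeqE//; exact: borel_setT.
  rewrite (_ : C _ = C s `&` [set y | f y (size s) = v]); first exact: borelI.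
  apply/seteqP; rewrite /C; split=> y /=; rewrite size_rcons mkseqS.
    by move/rcons_inj => [-> ->].
  by move=> [-> ->].
apply/seteqP; split=> [y Ufy|y [s sU /sU]//].
move: oU; rewrite openE => /(_ _ Ufy); rewrite /interior.
move=> /nbhs_cylinder[n nU]; exists (mkseq (f y) n); rewrite ?size_mkseq /C//.
  move=> x; rewrite /= size_mkseq => E; apply: nU => i i_n.
  by rewrite -(nth_mkseq (f y 0%N) _ i_n) E nth_mkseq.
by rewrite /= size_mkseq.
Qed.

(** * Souslin schemes *)

Lemma metric_dense_near (R : realType) (T : topologicalType) (d : T -> T -> R)
    (D : set T) (x : T) (e : R) :
  is_metric d -> metric_compatible d -> dense D -> 0 < e ->
  exists2 p, D p & d p x < e.
Proof.
move=> [_ d0 dC _] dT dD e0.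
have [|p [xp Dp]] := dD (interior [set y | d x y < e]) _ (open_interior _).
  by exists x; apply/dT; exists e.
by exists p => //; rewrite dC; exact: (interior_subset xp).
Qed.

(** Write [B] as the image of a Polish [Z] under [g]. A sequence [s] codes points of a countable
    dense set that approximate [z] ever more closely, [S s] collects the [z] so approximated, and
    [F s] is the closure of its image. *)
Lemma analytic_souslin (R : realType) (Y : topologicalType) (B : set Y) :
  polish R Y -> analytic R B ->
  exists F : seq nat -> set Y,
    [/\ forall s, closed (F s),
        forall s t, F (s ++ t) `<=` F s &
        forall y, B y <-> exists x : nat -> nat, forall n, F (mkseq x n) y].
Proof.
move=> [_ [dY [[dYge0 dY0 dYC dYD] dYT _]]].
move=> [Z [[[D cD dD] [dZ [mZ dZT dZc]]] [g cg gB]]].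
have [_ _ dZC dZD] := mZ.
have /countable_injP[code codeI] := cD.
pose S (s : seq nat) := [set z : Z | forall i, (i < size s)%N ->
  exists p, [/\ D p, code p = nth 0%N s i & dZ p z < i.+1%:R^-1]].
exists (fun s => closure (g @` S s)); split=> [s|s t|y].
- exact: closed_closure.
- apply/closureS/image_subset => z zs i i_s.
  have [|p [Dp pE pz]] := zs i; first by rewrite size_cat ltn_addr.
  by exists p; split=> //; rewrite pE nth_cat i_s.
split=> [|[x xy]].
  rewrite -gB => -[z _ <-].
  have /choice[p pP] : forall i : nat, exists p, D p /\ dZ p z < i.+1%:R^-1.
    move=> i; have i0 : (0 : R) < i.+1%:R^-1 by rewrite invr_gt0.
    by have [p] := metric_dense_near z mZ dZT dD i0; exists p.
  exists (code \o p) => n; apply: subset_closure; exists z => // i.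
  rewrite size_mkseq => i_n; have [Dp pz] := pP i.
  by exists (p i); split=> //; rewrite nth_mkseq.
(* Each closure contains [y], so no [S] along [x] is empty; length [n.+1] gives access to entry
   [n]. *)
have /choice[z zx] : forall n, exists z, S (mkseq x n.+1) z.
  move=> n; have [_ [[z zn _] _]] := xy n.+1 setT filterT.
  by exists z.
(* Both points are close to the same dense point, since [code] is injective on [D]. *)
have Sdist n z1 z2 : S (mkseq x n.+1) z1 -> S (mkseq x n.+1) z2 ->
    dZ z1 z2 < n.+1%:R^-1 + n.+1%:R^-1.
  move=> /(_ n) + /(_ n); rewrite size_mkseq => /(_ (ltnSn n))[p [Dp pE pz1]].
  move=> /(_ (ltnSn n))[q [Dq qE qz2]].
  have pq : p = q by apply: codeI; rewrite ?inE// pE qE.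
  apply: le_lt_trans (dZD _ p _) _; rewrite dZC; apply: ltrD => //.
  by rewrite pq.
have SW m n : (m <= n)%N -> S (mkseq x n) `<=` S (mkseq x m).
  move=> mn w wn i; rewrite size_mkseq => im.
  have [|p [Dp pE pw]] := wn i; first by rewrite size_mkseq (leq_trans im).
  exists p; split=> //; rewrite pE !nth_mkseq//; exact: leq_trans mn.
have small (e : R) : 0 < e -> exists N : nat, N.+1%:R^-1 + N.+1%:R^-1 < e.
  move=> e0; have [|N Ne] := @natSinv_lt R (e / 2); first by rewrite divr_gt0.
  by exists N; rewrite [e]splitr ltrD.
have [e e0|l zl] := dZc z.
  have [N Ne] := small e e0; exists N => m n Nm Nn; apply: lt_trans Ne.
  by apply: Sdist; [apply: SW (zx m)|apply: SW (zx n)].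
rewrite -gB; exists l => //; apply/dY0/eqP; apply: contraT => gly.
(* If [g l] and [y] differed, the image of [S] at a long initial segment would stay within half
   their distance of [g l], and its closure would miss [y]. *)
set e := dY (g l) y / 2.
have e0 : 0 < e by rewrite divr_gt0// lt_neqAle eq_sym gly dYge0.
have [r r0 rg] : exists2 r, 0 < r & forall w, dZ l w < r -> dY (g l) (g w) < e.
  have /dZT[r r0 rg] : nbhs l (g @^-1` [set y' | dY (g l) y' < e]).
    by apply: cg; apply/dYT; exists e.
  by exists r.
have r20 : 0 < r / 2 by rewrite divr_gt0.
have [N Nr] := small _ r20.
have [M _ zM] : \forall m \near \oo, dZ l (z m) < r / 2.
  by apply: (zl [set w | dZ l w < r / 2]); apply/dZT; exists (r / 2).
have lS w : S (mkseq x N.+1) w -> dY (g l) (g w) < e.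
  move=> Sw; apply: rg; apply: le_lt_trans (dZD _ (z (maxn M N)) _) _.
  rewrite [ltRHS]splitr ltrD//; first exact: zM (leq_maxl _ _).
  apply: lt_trans Nr; apply: Sdist => //; apply: SW (zx _).
  by rewrite ltnS leq_maxr.
have [|_ [[w Sw <-] /= gwy]] := xy N.+1 [set y' | dY y y' < e].
  by apply/dYT; exists e.
have := dYD (g l) (g w) y; rewrite leNgt [ltRHS]splitr ltrD ?lS//.
by rewrite dYC.
Qed.

(** * The reduction *)

Lemma injective_unbounded (h : nat -> nat) (n c : nat) :
  injective h -> exists m, (n <= m)%N /\ (c < h m)%N.
Proof.
move=> hI; apply: contrapT => nh.
(* Pigeonhole: [c.+2] positions cannot inject into the [c.+1] values up to [c]. *)
suff : (size (map h (iota n c.+2)) <= size (iota 0 c.+1))%N.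
  by rewrite size_map !size_iota ltnn.
apply: uniq_leq_size; first by rewrite map_inj_uniq// iota_uniq.
move=> _ /mapP[m /[!mem_iota]/andP[nm _] ->]; rewrite leq0n add0n ltnS leqNgt /=.
by apply/negP => cm; apply: nh; exists m.
Qed.

Lemma injective_increasing_subsequence (h : nat -> nat) : injective h ->
  exists j : nat -> nat, forall i, (j i < j i.+1)%N /\ (h (j i) < h (j i.+1))%N.
Proof.
move=> hI; have /choice[next nextP] : forall n, exists m,
    (n < m)%N /\ (h n < h m)%N.
  by move=> n; exact: injective_unbounded.
by exists (fun i => iter i next 0%N) => i; exact: nextP.
Qed.

(* Off the enumerated tree the sequence is negative and strictly decreasing, so
   that a monotone subsequence meets these positions at most once. *)
Definition tree_seq (T : seq nat -> Prop) (n : nat) : rat :=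
  if @pickle_inv (seq nat) n is Some s then
    if `[< T s >] then kb s else - n.+1%:R
  else - n.+1%:R.

Lemma tree_seq_pickle (T : seq nat -> Prop) (s : seq nat) :
  T s -> tree_seq T (pickle s) = kb s.
Proof. by move=> Ts; rewrite /tree_seq pickleK_inv asboolT. Qed.

Lemma tree_seq_cases (T : seq nat -> Prop) (n : nat) :
  (exists s, [/\ pickle s = n, T s & tree_seq T n = kb s]) \/
  tree_seq T n = - n.+1%:R.
Proof.
rewrite /tree_seq; have := @pickle_invK (seq nat) n.
case: pickle_inv => [s /= sn|_]; last by right.
by case: asboolP => Ts; [left; exists s|right].
Qed.

Lemma tree_seq_L_set (T : seq nat -> Prop) :
  (forall s t, T (s ++ t) -> T s) ->
  L_set (fun p q : rat => p <= q) (tree_seq T) <->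
  exists x : nat -> nat, forall n, T (mkseq x n).
Proof.
move=> Tpre; split=> [[k [kS kle]]|[x Tx]].
  apply: kb_ascending_branch => //.
  (* A filler lies strictly below every earlier term, so only the first chosen position can hold
     one; hence [k i.+1]. *)
  have /choice[s sP] : forall i, exists s, [/\ pickle s = k i.+1, T s &
      tree_seq T (k i.+1) = kb s].
    move=> i; have [//|E] := tree_seq_cases T (k i.+1).
    have := kle i; rewrite E leNgt.
    have [[s [_ _ ->]]|->] := tree_seq_cases T (k i).
      have /andP[s0 _] := kb_itv s.
      by rewrite (lt_le_trans _ s0)// oppr_lt0 ltr0n.
    by rewrite ltrN2 ltr_nat ltnS kS.
  exists s => i; last by have [] := sP i.
  have [pi _ si] := sP i; have [pS _ sS] := sP i.+1.
  (* Distinct positions carry distinct nodes, so injectivity of [kb] makes the inequality strict. *)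
  rewrite lt_neqAle -si -sS kle andbT si sS; apply/eqP => /kb_inj sE.
  by have := kS i.+1; rewrite -pi -pS sE ltnn.
have hI : injective (fun n => pickle (mkseq x n)).
  move=> m n /(pcan_inj pickleK) /(congr1 size).
  by rewrite !size_mkseq.
(* Thin out the branch so that the codes of its nodes increase along with their lengths. *)
have [j jP] := injective_increasing_subsequence hI.
exists (fun i => pickle (mkseq x (j i))); split=> i.
  by have [] := jP i.
have kb_mono : {homo (kb \o mkseq x) : m n / (m < n)%N >-> m < n}.
  apply: homo_ltn => [? ? ?|m]; first exact: lt_trans.
  by rewrite [X in _ < X]/comp mkseqS kb_rcons.
by rewrite !tree_seq_pickle// ltW// (kb_mono (j i) (j i.+1))//; case: (jP i).
Qed.

Lemma tree_seq_borel (Y : topologicalType) (F : seq nat -> set Y) :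
  (forall s, borel (F s)) ->
  borel_map ((fun y => tree_seq (F^~ y)) : Y -> discrete_seq_space rat).
Proof.
move=> bF; apply: borel_map_discrete_seq => n v; rewrite /tree_seq.
case: pickle_inv => [s|]; last exact: (borel_cst (_ = v)).
rewrite (_ : mkset _ = (F s `&` [set _ | kb s = v]) `|`
                       (~` F s `&` [set _ | - n.+1%:R = v])).
  apply: borelU; apply: borelI => //; try exact: (borel_cst (_ = v)).
  exact: borelC.
apply/seteqP; split=> y /=; case: asboolP => Fy.
- by left.
- by right.
- by case=> -[].
- by case=> -[].
Qed.

Theorem theorem3p7 (R : realType) :
  Sigma11_complete R (L_set (fun p q : rat => (p <= q)%R)).
Proof.
split.
- exact: (discrete_seq_space_polish R (0 : rat)).
- exact: L_set_analytic.
- move=> Y B pY aB; have [F [cF Fpre BF]] := analytic_souslin pY aB.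
  exists (fun y => tree_seq (F^~ y)).
    by apply: tree_seq_borel => s; exact: borel_closed.
  apply/seteqP; split=> y.
    by move/tree_seq_L_set => Fy; apply/BF/Fy => s t /Fpre.
  by move/BF => Fy; apply/tree_seq_L_set => // s t /Fpre.
Qed.
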